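(* Every weakly locally linearly convex domain in $\mathbb C^n$ is pseudoconvex.
   Context: A domain $D\subset\mathbb C^n$ is called weakly locally linearly convex if for each point $a\in\partial D$ there exist a complex (affine) hyperplane $H_a$ through $a$ and a neighborhood $U_a$ of $a$ such that $H_a\cap D\cap U_a=\varnothing$. *)

(* Defs.v *)
From HB Require Import structures.
From mathcomp Require Import all_boot all_order all_algebra.
From mathcomp Require Import complex.
From mathcomp Require Import all_classical all_reals all_analysis.

Set Implicit Arguments.
Unset Strict Implicit.
Unset Printing Implicit Defensive.

Import Order.TTheory GRing.Theory Num.Theory.
Import numFieldNormedType.Exports.
Local Open Scope classical_set_scope.
Local Open Scope ring_scope.
Local Open Scope complex_scope.

(* The topology of MathComp-Analysis is attached to the sort of a numFieldType,
   not to the bare type [R[i]]; hence the cast.  Norms take values in [R[i]]. *)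
Notation Cplx R := (complex R : numFieldType).

Definition boundary (T : topologicalType) (A : set T) : set T :=
  closure A `\` A°.

Definition domain (T : topologicalType) (D : set T) : Prop :=
  [/\ open D, connected D & D !=set0].

Section Cn.
Variable R : realType.

Definition complex_hyperplane (n : nat) (H : set 'rV[Cplx R]_n) : Prop :=
  exists (c : 'cV[Cplx R]_n) (b : Cplx R),
    c != 0 /\ H = [set z | (z *m c) 0 0 = b].

Definition weakly_locally_linearly_convex (n : nat) (D : set 'rV[Cplx R]_n)
    : Prop :=
  forall a, boundary D a ->
    exists H U : set 'rV[Cplx R]_n,
      [/\ complex_hyperplane H, H a, nbhs a U & H `&` D `&` U = set0].

Definition upper_semicontinuous_on (T : topologicalType) (W : set T)
    (v : T -> \bar R) : Prop :=
  forall x, W x ->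
    (v x < +oo)%E /\
    (forall a : R, (v x < a%:E)%E ->
       \forall y \near within W (nbhs x), (v y < a%:E)%E).

Definition circle_mean (v : Cplx R -> \bar R) (a : Cplx R) (r : R) : \bar R :=
  (((2 * pi)^-1)%R%:E *
   \int[lebesgue_measure]_(t in `[0%R, (2 * pi)%R])
     v (a + r%:C * (cos t +i* sin t))%R)%E.

(* [W] is meant to be open.  The value -oo is allowed, and the function
   identically -oo on a component of [W] counts as subharmonic. *)
Definition subharmonic_on (W : set (Cplx R)) (v : Cplx R -> \bar R) : Prop :=
  upper_semicontinuous_on W v /\
  (forall (a : Cplx R) (r : R), 0 < r ->
     [set z : Cplx R | `|z - a| <= r%:C] `<=` W ->
     (v a <= circle_mean v a r)%E).

Definition plurisubharmonic_on (n : nat) (D : set 'rV[Cplx R]_n)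
    (u : 'rV[Cplx R]_n -> \bar R) : Prop :=
  upper_semicontinuous_on D u /\
  (forall z w : 'rV[Cplx R]_n,
     subharmonic_on [set t : Cplx R | D (z + t *: w)]
                    (fun t => u (z + t *: w))).

Definition relatively_compact_in (T : topologicalType) (D A : set T) : Prop :=
  compact (closure A) /\ closure A `<=` D.

(* Existence of a continuous plurisubharmonic exhaustion function. *)
Definition pseudoconvex (n : nat) (D : set 'rV[Cplx R]_n) : Prop :=
  exists u : 'rV[Cplx R]_n -> R,
    [/\ {within D, continuous u},
        plurisubharmonic_on D (fun z => (u z)%:E)
      & forall c : R, relatively_compact_in D [set z | D z /\ u z < c]].

End Cn.

(* Main.v *)
Require Import Defs.
From mathcomp Require Import all_boot all_order all_algebra.
From mathcomp Require Import complex.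
From mathcomp Require Import ring lra.
From mathcomp Require Import all_classical all_reals all_analysis.
Import Order.TTheory GRing.Theory Num.Theory.
Import numFieldNormedType.Exports.
Set Implicit Arguments.
Unset Strict Implicit.
Unset Printing Implicit Defensive.
Local Open Scope classical_set_scope.
Local Open Scope ring_scope.
Local Open Scope complex_scope.

(** Let delta(z) be the distance from z to the complement of D, truncated at 1,
    replaced by 1 / max(1, |z|) where the latter is smaller.  The function
    u = - log delta is continuous on D and its sublevel sets are relatively
    compact ([exhaustion_relatively_compact]), so all that has to be shown is
    the mean value inequality for u on closed discs contained in D.

    The geometric input is [disc_pushing]: when a family of analytic discs, with
    boundaries inside D, moves from D towards the boundary of D, a first contact
    at an interior point of a disc is impossible.  At the contact point a
    hyperplane avoids D locally; restricted to the discs, its equation has no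
    zeros before the contact and one zero at the contact.  By Hurwitz's theorem
    ([hurwitz]) it vanishes identically near the contact point, so the disc
    stays outside D there, and a suitable choice of the contact point excludes
    this.  Polynomial discs suffice, and for polynomials Hurwitz's theorem
    follows from an elementary Harnack inequality on the product of the root
    distances ([poly_harnack]).

    Applied to the discs z + t w + h(t) v with |v| < 1, this says: if a
    polynomial h satisfies |h| <= delta on the boundary of a disc, then also at
    its centre ([gauge_poly_principle]).  This property of delta implies the
    mean value inequality for - log delta ([submean_of_polys]).  Indeed, a
    Fejer sum gives a polynomial f whose real part is uniformly close to
    - log delta on the circle and whose value at the centre is nearly the mean
    of - log delta ([fejer_approx]).  Polynomials of the form (1 - f / m)^m
    approximate exp(- f) ([exp_poly_approx]), whose modulus is about delta on
    the circle; comparing the values at the centre gives the inequality. *)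


(** * Real-valued norms over the complex numbers *)

Section RealNorm.
Variable R : realType.
Implicit Types V : normedZmodType (Cplx R).

(** A norm over [Cplx R] is a complex number; suprema, logarithms and integrals
    need it in [R]. *)
Definition rnorm V (x : V) : R := complex.Re `|x|.

Lemma normr_rnorm V (x : V) : `|x| = (rnorm x)%:C.
Proof. by rewrite /rnorm RRe_real // realE normr_ge0. Qed.

Lemma rnorm_ge0 V (x : V) : 0 <= rnorm x.
Proof. by rewrite -lecR -normr_rnorm normr_ge0. Qed.

Lemma rnormD V (x y : V) : rnorm (x + y) <= rnorm x + rnorm y.
Proof. by rewrite -lecR rmorphD /= -!normr_rnorm ler_normD. Qed.

Lemma rnormN V (x : V) : rnorm (- x) = rnorm x.
Proof. by rewrite /rnorm normrN. Qed.

Lemma rnormB V (x y : V) : rnorm (x - y) = rnorm (y - x).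
Proof. by rewrite -rnormN opprB. Qed.

Lemma rnorm0 V : rnorm (0 : V) = 0.
Proof. by rewrite /rnorm normr0. Qed.

Lemma rnorm_eq0 V (x : V) : (rnorm x == 0) = (x == 0).
Proof. by rewrite -[RHS]normr_eq0 normr_rnorm -(inj_eq (@complexI R)). Qed.

Lemma rnorm_gt0 V (x : V) : (0 < rnorm x) = (x != 0).
Proof. by rewrite lt_def rnorm_eq0 rnorm_ge0 andbT. Qed.

Lemma rnorm_sum V (I : Type) (r : seq I) (P : pred I) (F : I -> V) :
  rnorm (\sum_(i <- r | P i) F i) <= \sum_(i <- r | P i) rnorm (F i).
Proof.
elim/big_ind2: _ => [|x a y b xa yb|//]; first by rewrite rnorm0.
exact: le_trans (rnormD _ _) (lerD xa yb).
Qed.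

Lemma rnormM (x y : Cplx R) : rnorm (x * y) = rnorm x * rnorm y.
Proof. by apply: (@complexI R); rewrite rmorphM /= -!normr_rnorm normrM. Qed.

Lemma rnormX (x : Cplx R) k : rnorm (x ^+ k) = rnorm x ^+ k.
Proof. by apply: (@complexI R); rewrite rmorphXn /= -!normr_rnorm normrX. Qed.

Lemma rnormZ (V : normedModType (Cplx R)) (a : Cplx R) (x : V) :
  rnorm (a *: x) = rnorm a * rnorm x.
Proof. by apply: (@complexI R); rewrite rmorphM /= -!normr_rnorm normrZ. Qed.

Lemma rnorm1 : rnorm (1 : Cplx R) = 1.
Proof. by rewrite /rnorm normr1. Qed.

Lemma rnormC (x : R) : rnorm (x%:C : Cplx R) = `|x|.
Proof. by rewrite /rnorm normc_def /= expr0n addr0 sqrtr_sqr. Qed.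

Lemma rnorm_sqr (z : Cplx R) :
  rnorm z ^+ 2 = complex.Re z ^+ 2 + complex.Im z ^+ 2.
Proof.
by apply: (@complexI R); rewrite rmorphXn /= -normr_rnorm add_Re2_Im2.
Qed.

Lemma rnorm_conj (z : Cplx R) : rnorm (z^*%C : Cplx R) = rnorm z.
Proof. by rewrite /rnorm normcJ. Qed.

Lemma mul_conj_rnorm (z : Cplx R) : z * z^*%C = (rnorm z ^+ 2)%:C.
Proof. by rewrite rmorphXn /= -normr_rnorm sqr_normc. Qed.

Lemma ler_Re_rnorm (z : Cplx R) : `|complex.Re z| <= rnorm z.
Proof. by rewrite -lecR -normr_rnorm normc_ge_Re. Qed.

Lemma ler_Im_rnorm (z : Cplx R) : `|complex.Im z| <= rnorm z.
Proof.
rewrite -(@ler_pXn2r _ 2) ?nnegrE ?rnorm_ge0// rnorm_sqr real_normK ?num_real//.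
by rewrite lerDr sqr_ge0.
Qed.

Lemma rnorm_le_ReIm (z : Cplx R) :
  rnorm z <= `|complex.Re z| + `|complex.Im z|.
Proof.
rewrite -(@ler_pXn2r _ 2) ?nnegrE ?rnorm_ge0 ?addr_ge0//.
rewrite rnorm_sqr sqrrD !real_normK ?num_real//.
have : 0 <= `|complex.Re z| * `|complex.Im z| by rewrite mulr_ge0.
by rewrite -mulr_natl; lra.
Qed.
End RealNorm.

(** * Zeros, means and Fejer kernels of complex polynomials *)

(** Only the constant monomial survives: for 0 < k < M the powers of w ^+ k form
    a geometric progression with ratio different from 1 that closes up after M
    terms. *)
Lemma sum_horner_prim_root (F : idomainType) (q : {poly F}) (w z : F) M :
  M.-primitive_root w -> (size q <= M)%N ->
  \sum_(j < M) q.[z * w ^+ j] = M%:R * q.[0].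
Proof.
move=> wM qM; have M0 := prim_order_gt0 wM.
under eq_bigr do rewrite (horner_coef_wide _ qM).
rewrite exchange_big /= (bigD1 (Ordinal M0))//=.
rewrite [X in _ + X]big1 ?addr0 => [|k k0].
  rewrite (eq_bigr (fun=> q`_0)) => [|j _]; last exact: mulr1.
  by rewrite sumr_const card_ord horner_coef0 mulr_natl.
under eq_bigr do rewrite exprMn mulrA exprAC.
rewrite -mulr_sumr; apply/eqP; rewrite mulf_eq0; apply/orP; right.
have wk1 : w ^+ k != 1.
  rewrite -(prim_order_dvd wM) gtnNdvd// lt0n.
  by apply: contra k0 => /eqP k0; apply/eqP/val_inj.
have := subrX1 (w ^+ k) M; rewrite exprAC (prim_expr_order wM) expr1n subrr.
by move/esym/eqP; rewrite mulf_eq0 subr_eq0 (negPf wk1).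
Qed.

Section Polynomials.
Variable R : realType.
Local Notation C := (Cplx R).
Implicit Types (p q h f P Q : {poly C}) (t s z : C).

(** A root [a] at distance at least [r] from [t0] satisfies
    |t - a| <= |t - t0| + |t0 - a| <= 2 |t0 - a|, and this is used factor by
    factor. *)
Lemma harnack_prod (rs : seq C) (t0 t : C) (r : R) :
  (forall a, a \in rs -> r <= rnorm (a - t0)) -> rnorm (t - t0) <= r ->
  rnorm (\prod_(a <- rs) ('X - a%:P)).[t]
    <= 2 ^+ size rs * rnorm (\prod_(a <- rs) ('X - a%:P)).[t0].
Proof.
move=> + tr; elim: rs => [|a rs IH] hrs.
  by rewrite !big_nil !hornerC rnorm1 expr0 mul1r.
rewrite !big_cons !hornerM !rnormM !hornerXsubC exprS mulrACA.
apply: ler_pM; rewrite ?rnorm_ge0//; last first.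
  by apply: IH => b brs; apply: hrs; rewrite inE brs orbT.
have ra : r <= rnorm (a - t0) by apply: hrs; rewrite mem_head.
rewrite rnormB in ra; have := rnormD (t - t0) (t0 - a); rewrite subrKA.
lra.
Qed.

(** The Harnack inequality for zero-free functions; for polynomials of bounded
    degree it holds with an explicit constant, because the polynomial splits and
    all its roots are far from [t0]. *)
Lemma poly_harnack p (t0 t : C) (r : R) N : (size p <= N)%N ->
  (forall s, rnorm (s - t0) < r -> p.[s] != 0) -> rnorm (t - t0) <= r ->
  rnorm p.[t] <= 2 ^+ N * rnorm p.[t0].
Proof.
move=> pN p0 tr; have [->|pn0] := eqVneq p 0.
  by rewrite !horner0 rnorm0 mulr0.
have [rs prs] := closed_field_poly_normal p.
have srs : (size rs <= N)%N.
  apply: leq_trans pN; rewrite prs size_scale ?lead_coef_eq0//.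
  by rewrite size_prod_XsubC.
have ars a : a \in rs -> r <= rnorm (a - t0).
  move=> ars; rewrite leNgt; apply/negP => /p0 /negP; apply.
  by rewrite -/(root p a) prs rootZ ?lead_coef_eq0// root_prod_XsubC.
rewrite prs !hornerZ !rnormM mulrCA ler_wpM2l ?rnorm_ge0//.
apply: le_trans (harnack_prod ars tr) _.
by rewrite ler_wpM2r ?rnorm_ge0// ler_weXn2l// ler1n.
Qed.

(** Hurwitz's theorem along an affine pencil of polynomials.  The bound of
    [poly_harnack] depends only on the degree, so it survives the limit
    tau -> tau0, and there its right-hand side vanishes. *)
Lemma hurwitz P Q (tau0 e r : R) (t0 : C) : 0 < e ->
  (forall tau : R, tau0 - e < tau < tau0 ->
     forall s, rnorm (s - t0) < r -> (P + tau%:C *: Q).[s] != 0) ->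
  (P + tau0%:C *: Q).[t0] = 0 ->
  forall t, rnorm (t - t0) <= r -> (P + tau0%:C *: Q).[t] = 0.
Proof.
move=> e0 nz z0 t tr; apply/eqP; rewrite -rnorm_eq0.
pose N := maxn (size P) (size Q).
pose K := 2 ^+ N * rnorm Q.[t0] + rnorm Q.[t].
have K0 : 0 <= K by rewrite addr_ge0 ?mulr_ge0 ?rnorm_ge0// exprn_ge0.
set m := rnorm _.
(* The value at [t0] for the parameter tau0 - s is exactly - s Q(t0). *)
have mK (s : R) : 0 < s < e -> m <= s * K.
  case/andP => s0 se.
  have sE u : (P + tau0%:C *: Q).[u]
      = (P + (tau0 - s)%:C *: Q).[u] + s%:C * Q.[u].
    by rewrite rmorphB /= !hornerE; ring.
  have tE : (P + (tau0 - s)%:C *: Q).[t0] = - (s%:C * Q.[t0]).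
    by apply/eqP; rewrite -addr_eq0 -sE z0.
  rewrite /m sE; apply: le_trans (rnormD _ _) _.
  rewrite mulrDr rnormM rnormC (ger0_norm (ltW s0)) lerD2r mulrCA.
  have -> : s * rnorm Q.[t0] = rnorm (P + (tau0 - s)%:C *: Q).[t0].
    by rewrite tE rnormN rnormM rnormC (ger0_norm (ltW s0)).
  apply: (@poly_harnack _ _ _ r) => //; last by apply: nz; lra.
  apply: leq_trans (size_polyD _ _) _; rewrite geq_max leq_maxl /=.
  exact: leq_trans (size_scale_leq _ _) (leq_maxr _ _).
have m0 : 0 <= m := rnorm_ge0 _.
rewrite eq_le m0 andbT leNgt; apply/negP => mgt0.
have K1 : 0 < K + 1 by lra.
have s0 : 0 < Num.min (e / 2) (m / (K + 1)) by rewrite lt_min !divr_gt0.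
have se : Num.min (e / 2) (m / (K + 1)) < e.
  by rewrite gt_min; apply/orP; left; lra.
have := mK _ (introT andP (conj s0 se)).
have : Num.min (e / 2) (m / (K + 1)) * K <= m / (K + 1) * K.
  by rewrite ler_wpM2r// ge_min lexx orbT.
have : m / (K + 1) * K < m.
  by rewrite mulrAC ltr_pdivrMr//; nra.
lra.
Qed.

(** On the unit circle the real part of [fejer N] is the Fejer kernel
    sum_(|k| < N) (1 - |k| / N) x^k; the double sum is the one that lets the
    identity [Re_fejer] be proved by induction on [N]. *)
Definition fejer N : {poly C} :=
  N%:R^-1 *: \sum_(m < N) (1 + 2%:R *: \sum_(k < m) 'X^(k.+1)).

Lemma size_fejer N : (size (fejer N) <= N)%N.
Proof.
apply: leq_trans (size_scale_leq _ _) _.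
apply: leq_trans (size_sum _ _ _) _; apply/bigmax_leqP => m _.
apply: leq_trans (size_polyD _ _) _; rewrite geq_max size_poly1.
rewrite (leq_trans _ (ltn_ord m))//=.
apply: leq_trans (size_scale_leq _ _) _.
apply: leq_trans (size_sum _ _ _) _; apply/bigmax_leqP => k _.
by rewrite size_polyXn; apply: leq_ltn_trans (ltn_ord k) (ltn_ord m).
Qed.

Lemma fejer_at0 N : (0 < N)%N -> (fejer N).[0] = 1.
Proof.
move=> N0; rewrite hornerZ horner_sum.
under eq_bigr => m _.
  rewrite hornerD hornerZ hornerC horner_sum big1 ?mulr0 ?addr0; last first.
    by move=> k _; rewrite hornerXn expr0n.
  over.
by rewrite sumr_const card_ord mulVf// pnatr_eq0 -lt0n.
Qed.

Lemma Re_sum (I : Type) (r : seq I) (F : I -> C) :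
  complex.Re (\sum_(i <- r) F i) = \sum_(i <- r) complex.Re (F i).
Proof. by apply: (big_morph (@complex.Re R)) => // -[? ?] [? ?]. Qed.

Lemma ReZ (a : R) (z : C) : complex.Re (a%:C * z) = a * complex.Re z.
Proof. by case: z => x y /=; rewrite mul0r subr0. Qed.

Lemma ReZn (z : C) n : complex.Re (n%:R * z) = n%:R * complex.Re z.
Proof. by rewrite -ReZ rmorph_nat. Qed.

Lemma ReZVn (z : C) n : complex.Re (n%:R^-1 * z) = n%:R^-1 * complex.Re z.
Proof. by rewrite -ReZ fmorphV rmorph_nat. Qed.

Lemma ReD (x y : C) : complex.Re (x + y) = complex.Re x + complex.Re y.
Proof. by case: x y => [? ?] [? ?]. Qed.

Lemma rnorm_sqrD (x y : C) :
  rnorm (x + y) ^+ 2 = rnorm x ^+ 2 + rnorm y ^+ 2 + 2 * complex.Re (x * y^*%C).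
Proof. by rewrite !rnorm_sqr; case: x y => [? ?] [? ?] /=; ring. Qed.

Lemma rnorm1_conj (x : C) : rnorm x = 1 -> x * x^*%C = 1.
Proof. by move=> x1; rewrite mul_conj_rnorm x1 expr1n. Qed.

Lemma Re_fejer N (x : C) : rnorm x = 1 ->
  complex.Re (fejer N).[x] = N%:R^-1 * rnorm (\sum_(k < N) x ^+ k) ^+ 2.
Proof.
move=> x1; rewrite hornerZ ReZVn; congr (_ * _).
rewrite horner_sum Re_sum; elim: N => [|N IH].
  by rewrite !big_ord0 rnorm0 expr0n.
rewrite !big_ord_recr /= IH rnorm_sqrD rnormX x1 !expr1n -addrA; congr (_ + _).
rewrite hornerD hornerZ hornerC (ReD 1) ReZn; congr (_ + _ * _).
rewrite horner_sum mulr_suml !Re_sum (reindex_inj rev_ord_inj) /=.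
apply: eq_bigr => k _; rewrite hornerXn.
rewrite rmorphXn /= subnSK//.
have -> : (x^*)%C ^+ N = (x^*)%C ^+ k * (x^*)%C ^+ (N - k) :> C.
  by rewrite -exprD subnKC// ltnW.
rewrite mulrA -exprMn rnorm1_conj// expr1n mul1r -rmorphXn /=.
by case: (x ^+ (N - k)).
Qed.

Lemma Re_fejer_ge0 N (x : C) : rnorm x = 1 -> 0 <= complex.Re (fejer N).[x].
Proof. by move=> x1; rewrite Re_fejer// mulr_ge0 ?invr_ge0 ?ler0n ?sqr_ge0. Qed.

(** Since (x - 1) (1 + x + ... + x^(N-1)) = x^N - 1 has modulus at most 2, the
    kernel is small against a quadratic weight.  This replaces the usual
    splitting of the circle into points near and far from 1. *)
Lemma Re_fejer_le N (x : C) : rnorm x = 1 ->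
  rnorm (x - 1) ^+ 2 * complex.Re (fejer N).[x] <= 4 / N%:R.
Proof.
move=> x1; rewrite Re_fejer// mulrCA -exprMn -rnormM -subrX1 mulrC.
rewrite ler_wpM2r ?invr_ge0 ?ler0n//.
have := rnormD (x ^+ N) (-1); rewrite rnormN rnorm1 rnormX x1 expr1n.
have := rnorm_ge0 (x ^+ N - 1); nra.
Qed.

End Polynomials.

(** * Mean values over roots of unity *)

Section Circle.
Variable R : realType.
Local Notation C := (Cplx R).

Definition cis (x : R) : C := (cos x +i* sin x)%C.

Lemma cisD x y : cis (x + y) = cis x * cis y.
Proof. by rewrite /cis cosD sinD; congr Complex; rewrite addrC. Qed.

Lemma cisX x k : cis x ^+ k = cis (x * k%:R).
Proof.
elim: k => [|k IH]; first by rewrite mulr0 /cis cos0 sin0.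
by rewrite exprS IH -cisD -natr1 mulrDr mulr1 addrC.
Qed.

Lemma rnorm_cis x : rnorm (cis x) = 1.
Proof.
apply/eqP; rewrite -(@eqrXn2 _ 2) ?rnorm_ge0//; apply/eqP.
by rewrite rnorm_sqr expr1n /= cos2Dsin2.
Qed.

Lemma cis_neq1 x : 0 < x < 2 * pi -> cis x != 1.
Proof.
case/andP => x0 x2pi; apply/eqP => -[cx1 _].
have sx : 0 < sin (x / 2) by apply: sin_gt0_pi; lra.
have := cosD (x / 2) (x / 2); rewrite -splitr cx1.
have := cos2Dsin2 (x / 2); nra.
Qed.

Definition unity_cis (M : nat) : C := cis (2 * pi / M%:R).

Lemma unity_cisX M j : unity_cis M ^+ j = cis (2 * pi / M%:R * j%:R).
Proof. exact: cisX. Qed.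

Lemma unity_cis_prim M : (0 < M)%N -> M.-primitive_root (unity_cis M).
Proof.
move=> M0; have MR : 0 < M%:R :> R by rewrite ltr0n.
apply/andP; split => //; apply/forallP => i; apply/eqP.
rewrite unity_rootE unity_cisX; have [->|iM] := eqVneq i.+1 M.
  by rewrite divfK ?lt0r_neq0// mulr_natl /cis cos2pi sin2pi eqxx.
apply/negbTE/cis_neq1; have pi0 := pi_gt0 R; apply/andP; split.
  by rewrite mulr_gt0 ?divr_gt0 ?mulr_gt0 ?ltr0n.
rewrite -mulrA gtr_pMr ?mulr_gt0// mulrC ltr_pdivrMr// mul1r ltr_nat.
by rewrite ltn_neqAle iM ltn_ord.
Qed.

(** The value at the centre is the average over sufficiently many roots of
    unity. *)
Lemma poly_max_principle (q : {poly C}) (m : R) :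
  (forall t, rnorm t = 1 -> rnorm q.[t] <= m) -> rnorm q.[0] <= m.
Proof.
move=> qm; pose M := (size q).+1; have MR : 0 < M%:R :> R by rewrite ltr0n.
have := sum_horner_prim_root 1 (@unity_cis_prim M isT) (leqnSn (size q)).
move=> /(congr1 (@rnorm R C)); rewrite rnormM -(rmorph_nat (real_complex R)).
rewrite rnormC ger0_norm ?ler0n// => E; rewrite -(ler_pM2l MR) -E.
apply: le_trans (rnorm_sum _ _ _) _.
have <- : \sum_(j < M) m = M%:R * m by rewrite sumr_const card_ord mulr_natl.
apply: ler_sum => j _; apply: qm.
by rewrite rnormM rnorm1 mul1r rnormX rnorm_cis expr1n.
Qed.

(** Fejer's theorem with the convolution replaced by an average over the [M]-th
    roots of unity, so that [f] is visibly a polynomial whose value at 0 is the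
    average of [g].  The quadratic term of the modulus of continuity is absorbed
    by [Re_fejer_le]. *)
Lemma fejer_approx (g : C -> R) (e K : R) (M N : nat) (w : C) :
  0 <= K -> (0 < N)%N -> (N <= M)%N -> M.-primitive_root w -> rnorm w = 1 ->
  (forall t s, rnorm t = 1 -> rnorm s = 1 ->
     g t - g s <= e + K * rnorm (t - s) ^+ 2) ->
  exists f : {poly C},
    f.[0] = (M%:R^-1 * \sum_(j < M) g (w ^+ j))%:C /\
    forall t, rnorm t = 1 -> g t <= complex.Re f.[t] + e + 4 * K / N%:R.
Proof.
move=> K0 N0 NM wM w1 gmod.
have MR : 0 < M%:R :> R by rewrite ltr0n (leq_trans N0).
pose f : {poly C} := M%:R^-1 *:
  \sum_(j < M) (g (w ^+ j))%:C *: (fejer R N \Po ((w^*)%C ^+ j *: 'X)).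
have fE t : f.[t] =
    M%:R^-1 * \sum_(j < M) (g (w ^+ j))%:C * (fejer R N).[t * (w^*)%C ^+ j].
  rewrite hornerZ horner_sum; congr (_ * _); apply: eq_bigr => j _.
  by rewrite hornerZ horner_comp [(_ *: 'X).[_]]hornerZ hornerX [_ * t]mulrC.
exists f; split=> [|t t1].
  rewrite fE rmorphM /= fmorphV rmorph_nat; congr (_ * _).
  rewrite rmorph_sum; apply: eq_bigr => j _.
  by rewrite mul0r fejer_at0// mulr1.
have wj1 j : rnorm (w ^+ j) = 1 by rewrite rnormX w1 expr1n.
pose x j : C := t * (w^*)%C ^+ j.
have x1 j : rnorm (x j) = 1 by rewrite rnormM rnormX rnorm_conj w1 expr1n mulr1.
have xw j : rnorm (x j - 1) = rnorm (t - w ^+ j).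
  rewrite -[LHS]mulr1 -(wj1 j) -rnormM mulrBl mul1r -mulrA -exprMn.
  by rewrite [_ * w]mulrC rnorm1_conj// expr1n mulr1.
(* The sampled kernel has total mass [M]: its degree is less than [M]. *)
have sum_x : \sum_(j < M) complex.Re (fejer R N).[x j] = M%:R.
  have wcM : M.-primitive_root ((w^*)%C : C) by rewrite fmorph_primitive_root.
  have := sum_horner_prim_root t wcM (leq_trans (size_fejer R N) NM).
  rewrite fejer_at0// mulr1 => /(congr1 (@complex.Re R)).
  by rewrite Re_sum -(rmorph_nat (real_complex R)).
rewrite fE -(ler_pM2l MR) !mulrDr ReZVn mulrA divff ?gt_eqF// mul1r.
rewrite Re_sum -{1}sum_x mulr_suml.
have -> : M%:R * (4 * K / N%:R) = \sum_(j < M) (4 * K / N%:R).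
  by rewrite sumr_const card_ord mulr_natl.
rewrite -sum_x [in X in _ + X + _]mulr_suml -!big_split /=.
apply: ler_sum => j _.
rewrite ReZ -/(x j).
have := gmod _ _ t1 (wj1 j); rewrite -xw.
have := Re_fejer_le N (x1 j); have := Re_fejer_ge0 N (x1 j).
set p := complex.Re _; set d := rnorm _ ^+ 2 => p0 dp gd.
have -> : 4 * K / N%:R = K * (4 / N%:R) by rewrite -mulrA mulrCA.
have := ler_wpM2l K0 dp; have := ler_wpM2r p0 gd; lra.
Qed.

Lemma rnorm_poly_circle (f : {poly C}) :
  exists2 B : R, 0 <= B & forall t, rnorm t = 1 -> rnorm f.[t] <= B.
Proof.
exists (\sum_(i < size f) rnorm f`_i).
  by rewrite sumr_ge0 // => i _; exact: rnorm_ge0.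
move=> t t1; rewrite horner_coef; apply: le_trans (rnorm_sum _ _ _) _.
by apply: ler_sum => i _; rewrite rnormM rnormX t1 expr1n mulr1.
Qed.

(** A polynomial substitute for exp(-f): with z = f - c take
    h = exp(-c) (1 - z / m)^m.  From 1 + x <= exp x,
    |1 - z / m|^2 = 1 - 2 Re z / m + |z|^2 / m^2
    is at most exp((- 2 Re z + |z|^2 / m) / m), and |z|^2 / m is negligible for
    large [m] because [f] is bounded on the circle.  The value at 0 is exactly
    exp(-c). *)
Lemma exp_poly_approx (f : {poly C}) (c e : R) : 0 < e -> f.[0] = c%:C ->
  exists h : {poly C}, h.[0] = (expR (- c))%:C /\
    forall t, rnorm t = 1 -> rnorm h.[t] <= expR (e - complex.Re f.[t]).
Proof.
move=> e0 f0; have [B B0 fB] := rnorm_poly_circle (f - (c%:C)%:P).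
have [m mR Bm] : exists2 m, 0 < m%:R :> R & B ^+ 2 <= e * m%:R.
  exists (Num.bound (B ^+ 2 / e)).+1; rewrite ?ltr0n// mulrC -ler_pdivrMr//.
  apply: le_trans (_ : (Num.bound (B ^+ 2 / e))%:R <= _).
    by apply/ltW/archi_boundP; rewrite divr_ge0 ?sqr_ge0// ltW.
  by rewrite ler_nat.
exists ((expR (- c))%:C *: (1 - m%:R^-1 *: (f - (c%:C)%:P)) ^+ m); split.
  by rewrite hornerZ horner_exp !hornerE f0 subrr mulr0 subr0 expr1n mulr1.
move=> t t1; have := fB t t1; set z := (f - _).[t] => zB.
have zE : z = f.[t] - c%:C by rewrite /z hornerD hornerN hornerC.
rewrite hornerZ horner_exp hornerD hornerN hornerZ hornerC -/z.
rewrite rnormM rnormC gtr0_norm ?expR_gt0// rnormX.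
have ReE : complex.Re f.[t] = complex.Re z + c.
  by rewrite zE; case: (f.[t]) => a b /=; ring.
rewrite (_ : e - _ = - c + m%:R * ((e - complex.Re z) / m%:R)); last first.
  by rewrite ReE mulrCA divff ?gt_eqF//; ring.
rewrite expRD expRM_natl ler_wpM2l ?expR_ge0//.
rewrite ler_pXn2r ?nnegrE ?rnorm_ge0 ?expR_ge0//; last by rewrite -(ltr0n R).
rewrite -(@ler_pXn2r _ 2) ?nnegrE ?rnorm_ge0 ?expR_ge0//.
rewrite -expRM_natl; apply: le_trans (expR_ge1Dx _).
rewrite rnorm_sqrD rnormN rnorm1 expr1n rnormM.
have -> : rnorm (m%:R^-1 : C) = m%:R^-1.
  by rewrite -(rmorph_nat (real_complex R)) -fmorphV rnormC ger0_norm//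
    invr_ge0 ltW.
have -> : complex.Re (1 * (- (m%:R^-1 * z))^*%C) = - (m%:R^-1 * complex.Re z).
  by rewrite mul1r -ReZVn; case: (m%:R^-1 * z).
have : (m%:R^-1 * rnorm z) ^+ 2 <= e / m%:R.
  rewrite exprMn expr2 -mulrA mulrC ler_pM2r ?invr_gt0// mulrC ler_pdivrMr//.
  by apply: le_trans Bm; rewrite ler_pXn2r ?nnegrE ?rnorm_ge0.
have : 0 <= e / m%:R by rewrite divr_ge0 ?ltW.
by rewrite mulrBl mulrBr [complex.Re z / _]mulrC; lra.
Qed.

(** The criterion that turns a maximum principle for polynomials into a mean
    value inequality.  Take a polynomial whose real part is slightly above [G]
    on the circle and whose value at 0 is about the average of [G]; the
    exponential of its opposite is approximated by a polynomial [h] to which the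
    hypothesis applies. *)
Lemma discrete_submean (G : C -> R) (e K : R) (M N : nat) (w : C) :
  0 < e -> 0 <= K -> (0 < N)%N -> (N <= M)%N ->
  M.-primitive_root w -> rnorm w = 1 ->
  (forall t s, rnorm t = 1 -> rnorm s = 1 ->
     G t - G s <= e + K * rnorm (t - s) ^+ 2) ->
  (forall h : {poly C},
     (forall t, rnorm t = 1 -> rnorm h.[t] <= expR (- G t)) ->
     rnorm h.[0] <= expR (- G 0)) ->
  G 0 <= M%:R^-1 * \sum_(j < M) G (w ^+ j) + 2 * e + 4 * K / N%:R.
Proof.
move=> e0 K0 N0 NM wM w1 Gmod Gpoly.
have [f [f0 fG]] := fejer_approx K0 N0 NM wM w1 Gmod.
set c := (M%:R^-1 * _) in f0 *; set d := 4 * K / N%:R in fG *.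
pose f1 := f + ((2 * e + d)%:C)%:P.
have f10 : f1.[0] = (c + (2 * e + d))%:C by rewrite hornerD hornerC f0 -rmorphD.
have [h [h0 hf]] := exp_poly_approx e0 f10.
have := Gpoly h; rewrite h0 rnormC gtr0_norm ?expR_gt0// ler_expR lerN2.
rewrite addrA; apply => t t1; apply: le_trans (hf t t1) _; rewrite ler_expR.
by have := fG t t1; rewrite hornerD hornerC ReD /=; lra.
Qed.
End Circle.

(** * Moduli of continuity and Riemann sums *)

Section Modulus.
Variables (R : realType) (T : ptopologicalType).

(** Uniform continuity in the shape required by the Fejer estimate.  At a
    diagonal point of A x A continuity alone gives the bound with any K >= 0;
    off the diagonal [d] is bounded away from 0 and a large [K] does.  A large K
    thus works near every point, hence on the whole compact set A x A. *)
Lemma compact_modulus (A : set T) (f : T -> R) (d : T -> T -> R) (e : R) :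
  compact A -> (forall x, A x -> {for x, continuous f}) ->
  (forall p : T * T, {for p, continuous (fun q => d q.1 q.2)}) ->
  (forall x y, d x y = 0 -> x = y) -> 0 < e ->
  exists2 K, 0 <= K &
    forall x y, A x -> A y -> f x - f y <= e + K * d x y ^+ 2.
Proof.
move=> cA cf cd d0 e0.
have /compact_near_coveringP cAA := compact_setX cA cA.
have KP : \forall K \near +oo%R, forall p, (A `*` A) p ->
    f p.1 - f p.2 <= e + K * d p.1 p.2 ^+ 2.
  apply: cAA => p [Ap1 Ap2].
  have cF : {for p, continuous (fun q : T * T => f q.1 - f q.2)}.
    have c1 : {for p, continuous (fun q : T * T => f q.1)}.
      by apply: (@continuous_comp _ _ _ fst f); [exact: cvg_fst|exact: cf].
    have c2 : {for p, continuous (fun q : T * T => f q.2)}.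
      by apply: (@continuous_comp _ _ _ snd f); [exact: cvg_snd|exact: cf].
    exact: (cvgB c1 c2).
  have [pp|pp] := eqVneq (d p.1 p.2) 0.
    have F0 : f p.1 - f p.2 < e by rewrite (d0 _ _ pp) subrr.
    have U : \forall q \near p, f q.1 - f q.2 < e by exact: (cvgr_lt _ cF).
    exists ([set q : T * T | f q.1 - f q.2 < e], [set K : R | 0 <= K]) => /=.
      by split => //; apply: nbhs_pinfty_ge; rewrite num_real.
    case=> q K /= [qe K0]; apply: le_trans (ltW qe) _.
    by rewrite lerDl mulr_ge0 ?sqr_ge0.
  have cD : {for p, continuous (fun q : T * T => d q.1 q.2 ^+ 2)}.
    apply: (@continuous_comp _ _ _ (fun q : T * T => d q.1 q.2)
      (fun x => x ^+ 2)).
      exact: cd.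
    exact: exprn_continuous.
  pose D := d p.1 p.2 ^+ 2; have D0 : 0 < D by rewrite exprn_even_gt0.
  have U : \forall q \near p, D / 2 < d q.1 q.2 ^+ 2.
    by apply: (cvgr_gt _ cD); rewrite -/D; lra.
  pose c := f p.1 - f p.2.
  have V : \forall q \near p, f q.1 - f q.2 < `|c| + 1.
    by apply: (cvgr_lt _ cF); rewrite -/c; have := ler_norm c; lra.
  exists ([set q : T * T | D / 2 < d q.1 q.2 ^+ 2 /\ f q.1 - f q.2 < `|c| + 1],
    [set K : R | (`|c| + 1) / (D / 2) <= K]) => /=.
    split; first exact: filterI.
    by apply: nbhs_pinfty_ge; rewrite num_real.
  case=> q K /= [[qD qc] cK]; apply: le_trans (ltW qc) _.
  have D2 : 0 < D / 2 by lra.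
  have c1 : 0 <= `|c| + 1 by rewrite addr_ge0.
  rewrite ler_pdivrMr// in cK.
  have K0 : 0 <= K by rewrite -(pmulr_lge0 _ D2); apply: le_trans cK.
  have := ler_wpM2l K0 (ltW qD); lra.
near (pinfty_nbhs R) => K; exists K.
  by near: K; apply: nbhs_pinfty_ge; rewrite num_real.
by move=> x y Ax Ay; apply: (near KP K _ (x, y)).
Unshelve. all: by end_near. Qed.
End Modulus.

Section Riemann.
Variable R : realType.
Notation mu := (@lebesgue_measure R).

Lemma continuous_itv_integrable (g : R -> R) (a b : R) :
  continuous g -> mu.-integrable `[a, b] (EFin \o g).
Proof.
move=> cg; apply: continuous_compact_integrable; first exact: segment_compact.
exact: continuous_subspaceT.
Qed.

Lemma riemann_sum_step (g : R -> R) (a b m : R) :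
  continuous g -> 0 <= a -> a <= b ->
  (forall x, a <= x <= b -> m <= g x) ->
  \int[mu]_(x in `[0, a]) g x + (b - a) * m <= \int[mu]_(x in `[0, b]) g x.
Proof.
move=> cg a0 ab mg.
have ib := continuous_itv_integrable 0 b cg.
rewrite -lerBrDl Rintegral_itvB//.
have -> : (b - a) * m = \int[mu]_(x in `]a, b]) m.
  rewrite Rintegral_cst// mulrC; congr (_ * _).
  apply/esym; rewrite [X in fine X](lebesgue_measure_itv `]a, b]) /= lte_fin.
  case: ifPn => [//|]; rewrite -leNgt => ba.
  by rewrite (le_anti (introT andP (conj ab ba))) subrr.
have iab : mu.-integrable `]a, b] (EFin \o g).
  apply: integrableS ib => //; apply: subset_itv; rewrite bnd_simp//.
apply: le_Rintegral => //; last first.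
  move=> x /=; rewrite in_itv /= => /andP[ax xb].
  by apply: mg; rewrite (ltW ax).
apply: (@integrableS _ _ _ mu `[a, b]) => //.
  by apply: subset_itv; rewrite bnd_simp.
by apply: (@continuous_itv_integrable (cst m)) => x; apply: cvg_cst.
Qed.

(** On each of the [M] intervals of length h = a / M the modulus of continuity
    gives g (left end point) <= g + e / 2 + K h^2, and [M] is chosen with
    K h^2 <= e / 2. *)
Lemma riemann_sum_le (g : R -> R) (a e : R) (N : nat) :
  continuous g -> 0 < a -> 0 < e ->
  exists M, [/\ (0 < M)%N, (N <= M)%N &
    M%:R^-1 * \sum_(j < M) g (a / M%:R * j%:R)
      <= a^-1 * \int[mu]_(x in `[0, a]) g x + e].
Proof.
move=> cg a0 e0.
have e2 : 0 < e / 2 by lra.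
have [|||K K0 gK] := @compact_modulus R R `[0, a] g (fun x y => x - y) (e / 2)
  (@segment_compact _ _ _) _ _ _ e2.
- by move=> x _; exact: cg.
- by move=> p; apply: cvgB; [exact: cvg_fst|exact: cvg_snd].
- by move=> x y /eqP; rewrite subr_eq0 => /eqP.
have [M [M0 NM KM]] : exists M,
    [/\ (0 < M)%N, (N <= M)%N & K * a ^+ 2 <= e / 2 * M%:R].
  exists (maxn N (Num.bound (K * a ^+ 2 / (e / 2)))).+1; split => //.
    by rewrite ltnW// ltnS leq_maxl.
  rewrite [leRHS]mulrC -ler_pdivrMr//.
  apply: le_trans (_ : (Num.bound (K * a ^+ 2 / (e / 2)))%:R <= _).
    by apply/ltW/archi_boundP; rewrite divr_ge0 ?mulr_ge0 ?sqr_ge0// ltW.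
  by rewrite ler_nat ltnW// ltnS leq_maxr.
exists M; split => //.
have MR : 0 < M%:R :> R by rewrite ltr0n.
have M1 : 1 <= M%:R :> R by rewrite ler1n.
pose h := a / M%:R; have h0 : 0 < h by rewrite divr_gt0.
have Kh : K * h ^+ 2 <= e / 2.
  rewrite expr_div_n mulrA ler_pdivrMr ?exprn_gt0//.
  apply: le_trans KM _; apply: ler_wpM2l; first exact: ltW.
  by rewrite expr2; nra.
have S k : (k <= M)%N -> \sum_(j < k) h * (g (h * j%:R) - e)
    <= \int[mu]_(x in `[0, h * k%:R]) g x.
  elim: k => [_|k IH kM].
    by rewrite big_ord0 mulr0 set_itv1 Rintegral_set1.
  rewrite big_ord_recr /=; apply: le_trans (lerD (IH (ltnW kM)) (lexx _)) _.
  have hk : h * k%:R <= h * k.+1%:R by rewrite ler_pM2l// ler_nat.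
  have -> : h * (g (h * k%:R) - e)
      = (h * k.+1%:R - h * k%:R) * (g (h * k%:R) - e).
    by rewrite -mulrBr -natrB// subSnn mulr1.
  apply: riemann_sum_step => //; first by rewrite mulr_ge0// ltW.
  move=> x /andP[x1 x2].
  have kh0 : 0 <= h * k%:R by rewrite mulr_ge0// ltW.
  have xa : h * k.+1%:R <= a.
    by rewrite /h mulrAC ler_pdivrMr// ler_pM2l// ler_nat.
  have := gK (h * k%:R) x; rewrite /= !in_itv /= kh0 (le_trans kh0 x1).
  rewrite (le_trans hk xa) (le_trans x2 xa) => /(_ isT isT).
  have : K * (h * k%:R - x) ^+ 2 <= K * h ^+ 2.
    apply: ler_wpM2l => //.
    by move: x1 x2; rewrite -natr1 mulrDr mulr1; nra.
  lra.
have := S M (leqnn M); rewrite /h divfK ?lt0r_neq0// -/h.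
rewrite -mulr_sumr sumrB sumr_const card_ord => SM.
rewrite -(ler_pM2l a0) mulrA -/h mulrDr mulrA divff ?lt0r_neq0// mul1r.
have : h * e *+ M = a * e.
  by rewrite -mulr_natr /h mulrAC divfK ?lt0r_neq0.
by move: SM; rewrite mulrBr mulrnAr; lra.
Qed.
End Riemann.

(** * Topology of C^n and the integral mean value inequality *)

Section Topology.
Variable R : realType.
Local Notation C := (Cplx R).

Lemma nbhs_rnormP (V : normedModType C) (x : V) (U : set V) :
  nbhs x U <-> exists2 e : R, 0 < e & forall y, rnorm (x - y) < e -> U y.
Proof.
split=> [/nbhs_normP [e /= e0 xU]|[e e0 xU]].
  have eE : (complex.Re e)%:C = e by rewrite RRe_real// gtr0_real.
  exists (complex.Re e); first by rewrite -ltcR eE.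
  by move=> y xy; apply: xU; rewrite /= normr_rnorm -eE ltcR.
apply/nbhs_normP; exists (e%:C); first by rewrite /= ltcR.
by move=> y; rewrite /= normr_rnorm ltcR; exact: xU.
Qed.

Lemma lipschitz_rnorm_continuous (V : normedModType C) (f : V -> R) (k : R) :
  (forall x y, f x - f y <= k * rnorm (x - y)) -> continuous f.
Proof.
move=> fk x; apply/cvgrPdist_lt => e e0; apply/nbhs_rnormP.
have k0 : 0 < `|k| + 1 by rewrite ltr_wpDl.
exists (e / (`|k| + 1)); first by rewrite divr_gt0.
move=> y; rewrite ltr_pdivlMr// => xy.
have := fk x y; have := fk y x; rewrite (rnormB y x).
have := ler_wpM2r (rnorm_ge0 (x - y)) (ler_norm k).
have := rnorm_ge0 (x - y); rewrite ltr_norml; lra.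
Qed.

Lemma rnorm_continuous (V : normedModType C) : continuous (@rnorm R V).
Proof.
apply: (@lipschitz_rnorm_continuous _ _ 1) => x y.
by rewrite mul1r lerBlDr -{1}(subrK y x) rnormD.
Qed.

Lemma Re_continuous : continuous (@complex.Re R : C -> R).
Proof.
apply: (@lipschitz_rnorm_continuous _ _ 1) => x y; rewrite mul1r.
have -> : complex.Re x - complex.Re y = complex.Re (x - y).
  by case: x y => [? ?] [? ?].
exact: le_trans (ler_norm _) (ler_Re_rnorm _).
Qed.

Lemma continuous_complex (T : topologicalType) (f g : T -> R) (x : T) :
  {for x, continuous f} -> {for x, continuous g} ->
  {for x, continuous (fun y => (f y +i* g y)%C : C)}.
Proof.
move=> cf cg U /= xU'; have [e e0 xU] := proj1 (@nbhs_rnormP C _ U) xU'.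
have e2 : 0 < e / 2 by lra.
move/cvgrPdist_lt : cf => /(_ _ e2) cf; move/cvgrPdist_lt : cg => /(_ _ e2) cg.
change (nbhs x ((fun y => (f y +i* g y)%C : C) @^-1` U)).
apply: filterS (filterI cf cg) => y /= [fy gy]; apply: xU.
by apply: le_lt_trans (rnorm_le_ReIm _) _; rewrite /=; lra.
Qed.

Lemma real_complex_continuous : continuous (real_complex R : R -> C).
Proof.
by move=> x; apply: continuous_complex; [exact: cvg_id|exact: cvg_cst].
Qed.

Lemma cis_continuous : continuous (@cis R).
Proof.
by move=> x; apply: continuous_complex;
  [exact: continuous_cos|exact: continuous_sin].
Qed.

Lemma closed_rnorm_le (V : normedModType C) (r : R) :
  closed [set t : V | rnorm t <= r].
Proof.
have /continuous_closedP := @rnorm_continuous V.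
by move=> /(_ _ (@closed_le _ r)).
Qed.

(** The closed disc is a closed subset of the image of a square. *)
Lemma compact_disc (r : R) : compact [set t : C | rnorm t <= r].
Proof.
pose Q : set (R * R) := `[- r, r] `*` `[- r, r].
apply: (@subclosed_compact _ _ ((fun p : R * R => (p.1 +i* p.2)%C : C) @` Q)).
- exact: closed_rnorm_le.
- apply: continuous_compact; last first.
    by apply: compact_setX; exact: segment_compact.
  apply: continuous_subspaceT => p.
  by apply: continuous_complex; [exact: cvg_fst|exact: cvg_snd].
- move=> [x y] /= xyr; exists (x, y) => //.
  split; rewrite /= in_itv /= -ler_norml.
    exact: le_trans (ler_Re_rnorm _) xyr.
  exact: le_trans (ler_Im_rnorm _) xyr.
Qed.

Lemma compact_circle : compact [set t : C | rnorm t = 1].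
Proof.
apply: (subclosed_compact _ (@compact_disc 1)); last by move=> t /= ->.
exact: (proj1 (continuous_closedP _) (@rnorm_continuous C) _ (@closed_eq _ 1)).
Qed.

Lemma rnorm_coord n (z : 'rV[C]_n) i : rnorm (z 0 i) <= rnorm z.
Proof.
rewrite -lecR -!normr_rnorm -[`|z|]/(mx_norm z) mx_normE -[leLHS]nngE num_le.
exact: (le_bigmax _ (fun ij : 'I_1 * 'I_n => `|z ij.1 ij.2|%:nng) (0, i)).
Qed.

Lemma rnorm_row_le n (z : 'rV[C]_n) (c : R) : 0 <= c ->
  (forall i, rnorm (z 0 i) <= c) -> rnorm z <= c.
Proof.
move=> c0 zc; have [->|z0] := eqVneq z 0; first by rewrite rnorm0.
have [|[i j]] := @mx_norm_neq0 C _ _ z.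
  by rewrite -[mx_norm z]/(`|z|) normr_eq0.
by rewrite -[mx_norm z]/(`|z|) /rnorm /= ord1 => ->; exact: zc.
Qed.

Lemma compact_ball_row n (r : R) : compact [set z : 'rV[C]_n | rnorm z <= r].
Proof.
apply: (@subclosed_compact _ _
  [set z : 'rV[C]_n | forall i, rnorm (z 0 i) <= r]).
- exact: closed_rnorm_le.
- have := @rV_compact C n (fun=> [set t : C | rnorm t <= r])
    (fun=> @compact_disc r).
  exact.
- by move=> z /= zr i; exact: le_trans (rnorm_coord _ _) zr.
Qed.

(** [discrete_submean] with the sampling refined: for a fixed kernel order [N]
    the number [M] of sample points may grow until the average is close to the
    integral. *)
Lemma submean_of_polys (G : C -> R) :
  (forall t, rnorm t = 1 -> {for t, continuous G}) ->
  (forall h : {poly C},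
     (forall t, rnorm t = 1 -> rnorm h.[t] <= expR (- G t)) ->
     rnorm h.[0] <= expR (- G 0)) ->
  G 0 <= (2 * pi)^-1 *
    \int[lebesgue_measure]_(x in `[0%R, (2 * pi)%R]) G (cis x).
Proof.
move=> cG Gpoly; apply/ler_addgt0Pr => e e0.
have e4 : 0 < e / 4 by lra.
have [|||K K0 Gmod] := @compact_modulus R C _ G
  (fun t s => rnorm (t - s)) (e / 4)
  compact_circle _ _ _ e4.
- by move=> t /=; exact: cG.
- move=> p; apply: (@continuous_comp _ _ _
    (fun q : C * C => q.1 - q.2) (@rnorm R C)).
    by apply: cvgB; [exact: cvg_fst|exact: cvg_snd].
  exact: rnorm_continuous.
- by move=> t s /eqP; rewrite rnorm_eq0 subr_eq0 => /eqP.
have [N N0 KN] : exists2 N, (0 < N)%N & 4 * K / N%:R <= e / 4.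
  exists (Num.bound (4 * K / (e / 4))).+1 => //.
  rewrite ler_pdivrMr ?ltr0n// [leRHS]mulrC -ler_pdivrMr//.
  apply: le_trans (_ : (Num.bound (4 * K / (e / 4)))%:R <= _).
    by apply/ltW/archi_boundP; rewrite divr_ge0 ?mulr_ge0// ltW.
  by rewrite ler_nat.
have cGc : continuous (G \o @cis R).
  move=> x; apply: continuous_comp; first exact: cis_continuous.
  exact/cG/rnorm_cis.
have pi2 : 0 < 2 * pi :> R by rewrite mulr_gt0 ?pi_gt0.
have [M [M0 NM]] := riemann_sum_le N cGc pi2 e4.
have := discrete_submean e4 K0 N0 NM (unity_cis_prim R M0) (rnorm_cis _)
  Gmod Gpoly.
under eq_bigr do rewrite unity_cisX.
rewrite /comp; lra.
Qed.
End Topology.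

(** * Pushing analytic discs through the domain *)

Section NumField.
Variable K : numFieldType.

Lemma horner_continuous (h : {poly K}) : continuous (horner h).
Proof.
elim/poly_ind: h => [|p c IH] t.
  rewrite (_ : horner 0 = cst 0); first exact: cst_continuous.
  by apply/funext => x; rewrite horner0.
rewrite (_ : horner (p * 'X + c%:P) = fun t => p.[t] * t + c); last first.
  by apply/funext => x; rewrite hornerMXaddC.
have cM : {for t, continuous (fun x : K => p.[x] * x)}.
  exact: (@continuousM K K (horner p) id t (IH t) (@cvg_id _ _)).
exact: (@continuousD K K K (fun x : K => p.[x] * x) (cst c) t cM
  (@cst_continuous _ _ c t)).
Qed.

Lemma push_continuous (T : topologicalType) (V : normedModType K) (z w v : V)
    (h : {poly K}) (f g : T -> K) : continuous f -> continuous g ->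
  continuous (fun q => z + g q *: w + (f q * h.[g q]) *: v).
Proof.
move=> cf cg q; apply: cvgD.
  by apply: cvgD; [exact: cvg_cst|apply: cvgZ; [exact: cg|exact: cvg_cst]].
apply: cvgZ; last exact: cvg_cst.
apply: cvgM; first exact: cf.
apply: (@continuous_comp _ _ _ g (horner h)); first exact: cg.
exact: horner_continuous.
Qed.

Lemma line_continuous (V : normedModType K) (z w : V) :
  continuous (fun t : K => z + t *: w).
Proof.
move=> t; have cw : {for t, continuous (fun s : K => s *: w)}.
  exact: (@continuousZ K V K id (cst w) t (@cvg_id _ _)
    (@cst_continuous _ _ w t)).
exact: (@continuousD K V K (cst z) _ t (@cst_continuous _ _ z t) cw).
Qed.
End NumField.

Section Push.
Variables (R : realType) (n : nat).
Local Notation C := (Cplx R).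
Implicit Types (z w v c : 'rV[C]_n) (D : set 'rV[C]_n).

(** Along the disc with parameter [tau], the equation of a hyperplane is a
    polynomial in [t] that depends affinely on [tau]; this is what [hurwitz]
    expects. *)
Lemma mulmx_pencil (K : comNzRingType) (z w v : 'rV[K]_n) (c : 'cV[K]_n)
    (b tau t : K) (h : {poly K}) :
  (((z *m c) 0 0 - b)%:P + ((w *m c) 0 0) *: 'X
     + tau *: (((v *m c) 0 0) *: h)).[t]
  = ((z + t *: w + (tau * h.[t]) *: v) *m c) 0 0 - b.
Proof.
rewrite !mulmxDl -!scalemxAl.
move: (z *m c) (w *m c) (v *m c) => x y u.
by rewrite !mxE !hornerD hornerC !hornerZ hornerX; ring.
Qed.

(** The continuity principle (Kontinuitaetssatz) for the discs
    A_tau(t) = z + t w + tau h(t) v, 0 <= tau <= 1.  If some disc left [D], let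
    tau0 be the first bad parameter and, among the points of A_tau0 outside [D],
    let t1 be one with the largest real part.  It is not on the circle and
    A_tau0(t1) is a boundary point, limit of the discs A_tau with tau < tau0,
    which lie in [D].  The hyperplane at this point avoids [D] locally, so its
    equation has no zero on A_tau near t1 for tau < tau0, but it vanishes at t1
    for tau = tau0.  By [hurwitz] the disc A_tau0 lies in the hyperplane near
    t1, hence outside [D]; moving t1 slightly to the right contradicts its
    choice. *)
Lemma disc_pushing D (z w v : 'rV[C]_n) (h : {poly C}) :
  open D -> weakly_locally_linearly_convex D ->
  (forall t : C, rnorm t <= 1 -> D (z + t *: w)) ->
  (forall (t : C) (s : R), rnorm t = 1 -> 0 <= s <= 1 ->
     D (z + t *: w + (s%:C * h.[t]) *: v)) ->
  forall t : C, rnorm t <= 1 -> D (z + t *: w + h.[t] *: v).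
Proof.
move=> oD lcD discD circD t0 t01; apply: contrapT => nD.
pose A (p : R * C) : 'rV[C]_n := z + p.2 *: w + (p.1%:C * h.[p.2]) *: v.
have cA : continuous A.
  apply: (@push_continuous C (R * C)%type _ z w v h (fun p => (p.1)%:C) snd).
    move=> p; apply: (@continuous_comp _ _ _ fst (real_complex R : R -> C)).
      exact: cvg_fst.
    exact: real_complex_continuous.
  by move=> p; exact: cvg_snd.
pose X : set (R * C) := `[0, 1] `*` [set t : C | rnorm t <= 1].
pose B := X `&` A @^-1` (~` D).
have cB : compact B.
  apply: compact_closedI.
    by apply: compact_setX; [exact: segment_compact|exact: compact_disc].
  by apply: (proj1 (continuous_closedP _) cA); exact: open_closedC.
have B0 : B !=set0.
  exists (1, t0); split; first by split; rewrite /= ?in_itv /= ?ler01 ?lexx.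
  by rewrite /A /= mul1r.
have [[tau0 t'] /set_mem Bt' mint] := compact_EVT_min B0 cB
  (continuous_subspaceT (fun p => @cvg_fst _ _ _ _ _)).
pose B1 := B `&` fst @^-1` [set x | x = tau0].
have cB1 : compact B1.
  apply: compact_closedI => //.
  apply: (proj1 (continuous_closedP _) (fun p => @cvg_fst _ _ _ _ _)).
  exact: closed_eq.
have cRe : continuous (fun p : R * C => complex.Re p.2).
  move=> p; apply: (@continuous_comp _ _ _ snd (@complex.Re R : C -> R)).
    exact: cvg_snd.
  exact: Re_continuous.
have [|[tau1 t1] /set_mem [Bt1 /= E1] maxt] :=
  compact_EVT_max _ cB1 (continuous_subspaceT cRe).
  by exists (tau0, t').
move: Bt1 maxt; rewrite {}E1 {tau1} => Bt1 maxt.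
have [[/= ] ] := Bt1; rewrite in_itv /= => /andP[tau00 tau01] t11 nDa.
have tau0_gt0 : 0 < tau0.
  rewrite lt_neqAle tau00 andbT; apply/eqP => E; apply: nDa.
  by rewrite /= /A -E /= mul0r scale0r addr0; exact: discD.
have t1_lt1 : rnorm t1 < 1.
  rewrite lt_neqAle t11 andbT; apply/eqP => E; apply: nDa.
  by apply: circD => //; rewrite tau00.
have inD (tau : R) (t : C) : 0 <= tau < tau0 -> rnorm t <= 1 -> D (A (tau, t)).
  move=> /andP[tau_ge0 tau_lt] tle1; apply: contrapT => nDt.
  have /mint : (tau, t) \in B.
    apply/mem_set; split => //; split => //=.
    by rewrite in_itv /= tau_ge0 (le_trans (ltW tau_lt)).
  by rewrite /= leNgt tau_lt.
have nbA U : nbhs (A (tau0, t1)) U -> exists2 e : R, 0 < e &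
    forall (tau : R) (t : C), `|tau0 - tau| < e -> rnorm (t1 - t) < e ->
      U (A (tau, t)).
  move=> /cA [[P Q]] /= [/nbhs_normP[e1 /= e10 P1]].
  move=> /(@nbhs_rnormP R C)[e2 e20 Q2] PQ.
  exists (Num.min e1 e2); first by rewrite lt_min e10.
  move=> tau t; rewrite !lt_min => /andP[te1 _] /andP[_ te2].
  by apply: (PQ (tau, t)); split; [exact: P1|exact: Q2].
have bda : boundary D (A (tau0, t1)).
  split; last by move/interior_subset.
  move=> U /nbA [e e0 AU].
  (* The discs with parameter below tau0 come arbitrarily close. *)
  pose tau := Num.max 0 (tau0 - e / 2).
  have tau_lt : tau < tau0 by rewrite gt_max tau0_gt0; lra.
  have tau_ge : tau0 - e / 2 <= tau by rewrite le_max lexx orbT.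
  exists (A (tau, t1)); split.
    by apply: inD; rewrite ?le_max ?lexx ?tau_lt.
  apply: AU; last by rewrite subrr rnorm0.
  by rewrite ger0_norm; lra.
have [H [U [[c [b [c0 HE]]] Ha aU HDU]]] := lcD _ bda.
have [e1 e10 AU] := nbA _ aU.
pose e := Num.min e1 (Num.min tau0 (1 - rnorm t1)).
have e0 : 0 < e by rewrite !lt_min e10 tau0_gt0 subr_gt0.
have [ee1 etau et1] : [/\ e <= e1, e <= tau0 & e <= 1 - rnorm t1].
  by rewrite !ge_min !lexx !orbT.
have rt (t : C) : rnorm (t - t1) < e -> rnorm t <= 1.
  by move=> te; have := rnormD (t - t1) t1; rewrite subrK; lra.
have HA (p : R * C) : H (A p) <->
    (((z *m c) 0 0 - b)%:P + ((w *m c) 0 0) *: 'X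
     + (p.1)%:C *: (((v *m c) 0 0) *: h)).[p.2] = 0.
  rewrite mulmx_pencil HE /=; split => [->|/eqP]; rewrite ?subrr//.
  by rewrite subr_eq0 => /eqP.
have zero : (((z *m c) 0 0 - b)%:P + ((w *m c) 0 0) *: 'X
     + tau0%:C *: (((v *m c) 0 0) *: h)).[t1] = 0 by apply: (HA (tau0, t1)).1.
have nonzero (tau : R) : tau0 - e < tau < tau0 ->
  forall s, rnorm (s - t1) < e ->
  (((z *m c) 0 0 - b)%:P + ((w *m c) 0 0) *: 'X
     + tau%:C *: (((v *m c) 0 0) *: h)).[s] != 0.
  move=> /andP[tau1 tau2] s st1; apply/eqP => /(HA (tau, s)).2 HAs.
  have : (H `&` D `&` U) (A (tau, s)).
    split; first split => //.
      by apply: inD; [lra|exact: rt].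
    by apply: AU; [rewrite ger0_norm; lra|rewrite rnormB; lra].
  by rewrite HDU.
pose t2 := t1 + (e / 2)%:C.
have t2t1 : rnorm (t2 - t1) = e / 2.
  by rewrite /t2 addrC addKr rnormC ger0_norm//; lra.
have HA2 : H (A (tau0, t2)).
  by apply/HA; apply: (hurwitz e0 nonzero zero); rewrite t2t1; lra.
have : B1 (tau0, t2).
  split=> //; split.
    split => /=; first by rewrite in_itv /= tau00.
    by apply: rt; rewrite t2t1; lra.
  move=> /= D2; have : (H `&` D `&` U) (A (tau0, t2)).
    split => //; apply: AU; first by rewrite subrr normr0.
    by rewrite rnormB t2t1; lra.
  by rewrite HDU.
by move=> /mem_set /maxt /=; rewrite /t2; case: (t1) => x y /=; lra.
Qed.
End Push.

(** * The exhaustion function *)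

Section Gauge.
Variables (R : realType) (n : nat) (D : set 'rV[Cplx R]_n).
Local Notation C := (Cplx R).
Implicit Types (z w v : 'rV[C]_n).

(** Radii are truncated at 1, which keeps the supremum finite when [D] is the
    whole space. *)
Definition inner_radii z : set R :=
  [set r | 0 <= r <= 1 /\ forall v, rnorm v < r -> D (z + v)].

Definition inradius z : R := sup (inner_radii z).

Lemma inner_radii_has_sup z : has_sup (inner_radii z).
Proof.
split; last by exists 1 => r [/andP[]].
by exists 0; split => [|v]; rewrite ?lexx ?ler01// ltNge rnorm_ge0.
Qed.

Lemma inradius_ge z (r : R) : 0 <= r <= 1 ->
  (forall v, rnorm v < r -> D (z + v)) -> r <= inradius z.
Proof. by move=> r01 rD; apply: (sup_upper_bound (inner_radii_has_sup z)). Qed.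

Lemma inradius_ge0 z : 0 <= inradius z.
Proof.
by apply: inradius_ge => [|v]; rewrite ?lexx ?ler01// ltNge rnorm_ge0.
Qed.

Lemma inradius_le1 z : inradius z <= 1.
Proof.
by apply: sup_le_ub => [|r [/andP[]]//]; case: (inner_radii_has_sup z).
Qed.

Lemma lt_inradius z v : rnorm v < inradius z -> D (z + v).
Proof.
move=> vz; have e0 : 0 < inradius z - rnorm v by rewrite subr_gt0.
have [r [_ rD] vr] := sup_adherent e0 (inner_radii_has_sup z).
by apply: rD; rewrite -/(inradius z) in vr; lra.
Qed.

Lemma inradius_gt0_in z : 0 < inradius z -> D z.
Proof. by rewrite -{2}(addr0 z) => z0; apply: lt_inradius; rewrite rnorm0. Qed.

Lemma inradius_gt0 z : open D -> D z -> 0 < inradius z.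
Proof.
rewrite openE => oD /oD /nbhs_rnormP[e e0 zD].
apply: (@lt_le_trans _ _ (Num.min 1 e)); first by rewrite lt_min ltr01.
apply: inradius_ge => [|v]; first by rewrite le_min ler01 ltW//= ge_min lexx.
rewrite lt_min => /andP[_ ve]; apply: zD.
by rewrite opprD addrA subrr add0r rnormN.
Qed.

Lemma inradius_lip z w : inradius z - inradius w <= rnorm (z - w).
Proof.
rewrite lerBlDl -lerBlDr.
have [r0|r0] := leP (inradius z - rnorm (z - w)) 0.
  exact: le_trans r0 (inradius_ge0 w).
apply: inradius_ge => [|v vr].
  by have := inradius_le1 z; have := rnorm_ge0 (z - w); lra.
have -> : w + v = z + (v - (z - w)).
  by rewrite opprB addrCA [z + _]addrC subrK addrC.
apply: lt_inradius; apply: le_lt_trans (rnormD _ _) _.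
by rewrite rnormN; lra.
Qed.

(** The second term forces the exhaustion function to infinity at infinity.  A
    minimum is used because the maximum principle for polynomials treats the two
    terms separately. *)
Definition gauge z : R := Num.min (inradius z) (Num.max 1 (rnorm z))^-1.

Lemma max1_gt0 (a : R) : 0 < Num.max 1 a.
Proof. by rewrite lt_max ltr01. Qed.

Lemma inv_max1_lip (a b : R) :
  (Num.max 1 a)^-1 - (Num.max 1 b)^-1 <= `|a - b|.
Proof.
have x0 := max1_gt0 a; have y0 := max1_gt0 b.
have xy : Num.max 1 b - Num.max 1 a <= `|a - b|.
  rewrite distrC lerBlDr ge_max; apply/andP; split.
    by rewrite ler_wpDl// le_max lexx.
  have := ler_norm (b - a).
  have : a <= Num.max 1 a by rewrite le_max lexx orbT.
  lra.
have x1 : 1 <= Num.max 1 a by rewrite le_max lexx.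
have y1 : 1 <= Num.max 1 b by rewrite le_max lexx.
move: (Num.max 1 a) (Num.max 1 b) x0 y0 xy x1 y1 => x y x0 y0 xy x1 y1.
have -> : x^-1 - y^-1 = (y - x) / (x * y) by field; rewrite !gt_eqF.
rewrite ler_pdivrMr ?mulr_gt0//; apply: le_trans xy _.
by rewrite ler_peMr// mulr_ege1.
Qed.

Lemma gauge_lip z w : gauge z - gauge w <= rnorm (z - w).
Proof.
have nzw : `|rnorm z - rnorm w| <= rnorm (z - w).
  have := rnormD (z - w) w; have := rnormD (w - z) z.
  by rewrite !subrK (rnormB w z) ler_norml; lra.
have := le_trans (inv_max1_lip (rnorm z) (rnorm w)) nzw.
have := inradius_lip z w; rewrite /gauge.
case: (leP (inradius z)) => ?; case: (leP (inradius w)) => ?; lra.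
Qed.

Lemma gauge_gt0 z : open D -> D z -> 0 < gauge z.
Proof. by move=> oD Dz; rewrite lt_min inradius_gt0// invr_gt0 max1_gt0. Qed.

Lemma gauge_continuous : continuous gauge.
Proof.
apply: (@lipschitz_rnorm_continuous _ _ _ 1) => z w.
by rewrite mul1r gauge_lip.
Qed.

Definition exhaustion z : R := - ln (gauge z).

Lemma exhaustion_continuous z : open D -> D z ->
  {for z, continuous exhaustion}.
Proof.
move=> oD Dz; have cl : {for z, continuous (@ln R \o gauge)}.
  apply: continuous_comp; first exact: gauge_continuous.
  exact/continuous_ln/gauge_gt0.
exact: (cvgN cl).
Qed.

Lemma expRN_exhaustion z : open D -> D z -> expR (- exhaustion z) = gauge z.
Proof. by move=> oD Dz; rewrite opprK lnK// posrE gauge_gt0. Qed.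

(** A bound on the exhaustion function bounds |z| from above and the inner
    radius from below; both conditions are closed. *)
Lemma exhaustion_relatively_compact (c : R) : open D ->
  relatively_compact_in D [set z | D z /\ exhaustion z < c].
Proof.
move=> oD.
pose K := [set z : 'rV[C]_n | rnorm z <= expR c] `&`
          inradius @^-1` [set x | expR (- c) <= x].
have inc : continuous inradius.
  apply: (@lipschitz_rnorm_continuous _ _ _ 1) => z w.
  by rewrite mul1r inradius_lip.
have clK : closed K.
  apply: closedI; first exact: closed_rnorm_le.
  by apply: (proj1 (continuous_closedP _) inc); exact: closed_ge.
have sK : [set z | D z /\ exhaustion z < c] `<=` K.
  move=> z [Dz zc]; have : expR (- c) < gauge z.
    by rewrite -expRN_exhaustion// ltr_expR ltrN2.
  rewrite lt_min => /andP[zr].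
  rewrite expRN ltf_pV2 ?posrE ?expR_gt0 ?max1_gt0// => zm.
  split; rewrite /= -?expRN ltW//.
  by apply: le_lt_trans zm; rewrite le_max lexx orbT.
split.
  apply: (subclosed_compact (@closed_closure _ _)
    (@compact_ball_row R n (expR c))).
  by move=> z /(closure_subset sK); rewrite -((closure_id _).1 clK) => -[].
move=> z /(closure_subset sK); rewrite -((closure_id _).1 clK) => -[_ /= zc].
by apply: inradius_gt0_in; apply: lt_le_trans zc; exact: expR_gt0.
Qed.

(** For the inner radius this is [disc_pushing]: if |h| is at most the distance
    to the complement on the circle, then each disc z + t w + h(t) v with
    |v| < 1 has its boundary in [D], hence its centre.  For the second term it
    is the maximum principle applied to [h] and to [h] times each coordinate of
    z + t w. *)
Lemma gauge_poly_principle z w (h : {poly C}) :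
  open D -> weakly_locally_linearly_convex D ->
  (forall t : C, rnorm t <= 1 -> D (z + t *: w)) ->
  (forall t : C, rnorm t = 1 -> rnorm h.[t] <= gauge (z + t *: w)) ->
  rnorm h.[0] <= gauge z.
Proof.
move=> oD lcD discD hle.
have hle1 t : rnorm t = 1 -> rnorm h.[t] <= 1.
  move=> /hle; rewrite le_min => /andP[h1 _].
  exact: le_trans h1 (inradius_le1 _).
have h01 : rnorm h.[0] <= 1 by exact: poly_max_principle.
rewrite le_min; apply/andP; split.
  apply: inradius_ge => [|v vh]; first by rewrite rnorm_ge0.
  have h0 : h.[0] != 0.
    by rewrite -rnorm_gt0; apply: le_lt_trans vh; exact: rnorm_ge0.
  pose v' := (h.[0])^-1 *: v.
  have v'1 : rnorm v' < 1.
    rewrite -(ltr_pM2l (_ : 0 < rnorm h.[0])) ?rnorm_gt0// -rnormZ scalerA.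
    by rewrite divff// scale1r mulr1.
  have -> : z + v = z + 0 *: w + h.[0] *: v'.
    by rewrite scale0r addr0 scalerA divff// scale1r.
  apply: disc_pushing => //; last by rewrite rnorm0 ler01.
  move=> t s t1 /andP[s0 s1]; apply: lt_inradius.
  have := hle t t1; rewrite le_min => /andP[ht _].
  have tle1 : rnorm t <= 1 by rewrite t1.
  have i0 := inradius_gt0 oD (discD t tle1).
  rewrite rnormZ rnormM rnormC ger0_norm//.
  have sh : s * rnorm h.[t] <= inradius (z + t *: w).
    by apply: le_trans ht; rewrite ler_piMl ?rnorm_ge0.
  apply: le_lt_trans (ler_wpM2r (rnorm_ge0 v') sh) _.
  by rewrite gtr_pMr.
rewrite -[leRHS]mul1r ler_pdivlMr ?max1_gt0//.
have -> : rnorm h.[0] * Num.max 1 (rnorm z)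
    = Num.max (rnorm h.[0]) (rnorm (h.[0] *: z)).
  by rewrite maxr_pMr ?rnorm_ge0// mulr1 rnormZ.
rewrite ge_max h01 /=; apply: rnorm_row_le => // i.
have := @poly_max_principle R (h * ((z 0 i)%:P + w 0 i *: 'X)) 1.
rewrite hornerM hornerD hornerC hornerZ hornerX mulr0 addr0 mxE; apply => t t1.
rewrite hornerM hornerD hornerC hornerZ hornerX rnormM.
have := hle t t1; rewrite le_min => /andP[_].
rewrite -[leRHS]mul1r ler_pdivlMr ?max1_gt0//; apply: le_trans.
rewrite ler_wpM2l ?rnorm_ge0// le_max; apply/orP; right.
by have := rnorm_coord (z + t *: w) i; rewrite !mxE mulrC.
Qed.

Lemma exhaustion_submean z w : open D -> weakly_locally_linearly_convex D ->
  (forall t : C, rnorm t <= 1 -> D (z + t *: w)) ->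
  exhaustion z <= (2 * pi)^-1 *
    \int[lebesgue_measure]_(x in `[0%R, (2 * pi)%R])
      exhaustion (z + cis x *: w).
Proof.
move=> oD lcD discD.
have cir (t : C) : rnorm t = 1 -> D (z + t *: w).
  by move=> t1; apply: discD; rewrite t1.
have := @submean_of_polys R (fun t => exhaustion (z + t *: w)).
rewrite scale0r addr0; apply => [t t1|h hle].
  apply: (@continuous_comp _ _ _ (fun t : C => z + t *: w) exhaustion).
    exact: line_continuous.
  by apply: exhaustion_continuous => //; exact: cir.
have Dz : D z by have := discD 0; rewrite scale0r addr0 rnorm0 => /(_ ler01).
rewrite expRN_exhaustion//; apply: (@gauge_poly_principle z w) => // t t1.
by rewrite -expRN_exhaustion//; [exact: hle|exact: cir].
Qed.
End Gauge.

Theorem corollary5p4 (R : realType) (n : nat) (D : set 'rV[Cplx R]_n) :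
  domain D -> weakly_locally_linearly_convex D -> pseudoconvex D.
Proof.
move=> [oD _ _] lcD; exists (exhaustion D).
have usc (T : topologicalType) (W : set T) (f : T -> 'rV[Cplx R]_n) :
    continuous f -> (forall x, W x -> D (f x)) ->
    upper_semicontinuous_on W (fun x => (exhaustion D (f x))%:E).
  move=> cf WD x Wx; split=> [|a]; first exact: ltry.
  rewrite lte_fin => xa.
  have ce : {for x, continuous (exhaustion D \o f)}.
    apply: continuous_comp; first exact: cf.
    by apply: exhaustion_continuous => //; exact: WD.
  by apply: filterS (cvgr_lt _ ce _ xa) => y ya _; rewrite lte_fin.
split.
- apply: continuous_in_subspaceT => z /set_mem Dz.
  exact: exhaustion_continuous.
- split; first by apply: (usc _ D id) => // x; exact: cvg_id.
  move=> z w; split; first by apply: usc => //; exact: line_continuous.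
  move=> a r r0 disc.
  have pointE (t : Cplx R) :
      z + a *: w + t *: (r%:C *: w) = z + (a + r%:C * t) *: w.
    by rewrite scalerA scalerDl addrA [t * _]mulrC.
  have discD (t : Cplx R) : rnorm t <= 1 -> D (z + a *: w + t *: (r%:C *: w)).
    move=> t1; rewrite pointE; apply: disc => /=.
    rewrite addrC addKr normr_rnorm lecR rnormM rnormC gtr0_norm//.
    by rewrite ger_pMr.
  have cexh : continuous
      (fun x => exhaustion D (z + a *: w + cis x *: (r%:C *: w))).
    move=> x; apply: (@continuous_comp _ _ _ (@cis R)
        (fun t : Cplx R => exhaustion D (z + a *: w + t *: (r%:C *: w)))).
      exact: cis_continuous.
    apply: (@continuous_comp _ _ _ _ (exhaustion D)).
      exact: line_continuous.
    by apply: exhaustion_continuous => //; apply: discD; rewrite rnorm_cis.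
  rewrite /circle_mean.
  under eq_integral do rewrite -[(_ +i* _)%C]/(cis _) -pointE.
  rewrite -[X in (_ * X)%E]fineK; last first.
    exact/integrable_fin_num/continuous_itv_integrable.
  by rewrite -EFinM lee_fin; exact: exhaustion_submean.
- move=> c; exact: exhaustion_relatively_compact.
Qed.
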